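(* Let $\phi:\mathbb{R}^n\rightarrow\mathbb{R}\cup\{+\infty\}$ be proper, lower semicontinuous, asymptotically level stable and bounded below. Let $B\in\mathbb{R}^{m\times n}$, $\lambda>0$, $p>0$ and $\gamma>0$. Then both optimization problems $$\min\{\phi(x)+\lambda\|Bx\|_0: x\in\mathbb{R}^n\}\quad\text{and}\quad \min\{\phi(x)+\lambda\psi_\gamma(Bx): x\in\mathbb{R}^n\}$$ have nonempty sets of optimal solutions (global minimizers).
   Context: $\|y\|_0$ denotes the number of nonzero entries of the vector $y$. For $p>0$, $\gamma>0$, the capped $\ell_p$ function is $\psi_\gamma(y)=\sum_{i=1}^m\varphi_\gamma(y_i)$ for $y\in\mathbb{R}^m$, where $\varphi_\gamma(t)=\min(\gamma|t|^p,1)$. A function $f:\mathbb{R}^n\to\mathbb{R}\cup\{+\infty\}$ is proper if it is not identically $+\infty$. Its asymptotic function is $f_\infty(d)=\liminf_{d'\to d,\,t\to+\infty} f(td')/t$, and $\mathrm{ker}(f_\infty)=\{d: f_\infty(d)=0\}$. Write $\mathrm{lev}(f,\alpha)=\{x: f(x)\le\alpha\}$. A proper lower semicontinuous $f$ is asymptotically level stable if for each $\rho>0$, each bounded real sequence $\{t^k\}_{k\in\mathbb{N}}$ and each sequence $\{x^k\}_{k\in\mathbb{N}}$ in $\mathbb{R}^n$ satisfying $x^k\in\mathrm{lev}(f,t^k)$, $\|x^k\|_2\to+\infty$, $x^k\|x^k\|_2^{-1}\to\bar x\in\mathrm{ker}(f_\infty)$, there exists $k_0\in\mathbb{N}$ such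 that $x^k-\rho\bar x\in\mathrm{lev}(f,t^k)$ for all $k\ge k_0$. *)

(* Defs.v *)
From mathcomp Require Import all_boot all_order all_algebra.
From mathcomp Require Import all_classical all_reals all_analysis.

Set Implicit Arguments.
Unset Strict Implicit.
Unset Printing Implicit Defensive.

Import Order.TTheory GRing.Theory Num.Theory.
Import numFieldNormedType.Exports.

Local Open Scope classical_set_scope.
Local Open Scope ring_scope.

(* The library's norm on matrices is the sup norm, hence this definition. *)
Definition l2norm (R : realType) (n : nat) (x : 'cV[R]_n) : R :=
  Num.sqrt (\sum_(i < n) x i ord0 ^+ 2).

Definition l0norm (R : realType) (m : nat) (y : 'cV[R]_m) : nat :=
  #|[set i : 'I_m | y i ord0 != 0]%SET|.

Definition capped_fun (R : realType) (p gamma t : R) : R :=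
  Num.min (gamma * `|t| `^ p) 1.

Definition capped_lp (R : realType) (p gamma : R) (m : nat) (y : 'cV[R]_m) : R :=
  \sum_(i < m) capped_fun p gamma (y i ord0).

(* Functions into R U {+oo} are functions into \bar R that avoid -oo; this
   codomain condition is the first clause of [proper_fun]. *)
Definition proper_fun (R : realType) (n : nat) (f : 'cV[R]_n -> \bar R) : Prop :=
  (forall x, f x != -oo%E) /\ (exists x, f x != +oo%E).

(* The bound must be a real: in \bar R every set is bounded below by -oo. *)
Definition bounded_below (R : realType) (n : nat) (f : 'cV[R]_n -> \bar R) : Prop :=
  exists c : R, forall x, (c%:E <= f x)%E.

Definition lev (R : realType) (n : nat) (f : 'cV[R]_n -> \bar R) (a : R) :
    set 'cV[R]_n :=
  [set x | (f x <= a%:E)%E].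

(* liminf of f (t d') / t as (d', t) tends to (d, +oo); d' = d is allowed. *)
Definition asymptotic_fun (R : realType) (n : nat) (f : 'cV[R]_n -> \bar R)
    (d : 'cV[R]_n) : \bar R :=
  limf_einf (fun u : 'cV[R]_n * R => (f (u.2 *: u.1)%R * (u.2^-1)%:E)%E)
    (filter_prod (nbhs d) (pinfty_nbhs R)).

Definition asymptotic_ker (R : realType) (n : nat) (f : 'cV[R]_n -> \bar R) :
    set 'cV[R]_n :=
  [set d | asymptotic_fun f d = 0%E].

Definition asymptotically_level_stable (R : realType) (n : nat)
    (f : 'cV[R]_n -> \bar R) : Prop :=
  forall (rho : R) (t : nat -> R) (x : nat -> 'cV[R]_n) (xbar : 'cV[R]_n),
    0 < rho ->
    bounded_fun t ->
    (forall k, lev f (t k) (x k)) ->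
    l2norm (x k) @[k --> \oo] --> +oo ->
    (l2norm (x k))^-1 *: x k @[k --> \oo] --> xbar ->
    asymptotic_ker f xbar ->
    exists k0 : nat, forall k : nat, (k0 <= k)%N ->
      lev f (t k) (x k - rho *: xbar).

Definition global_minimizers (R : realType) (n : nat) (F : 'cV[R]_n -> \bar R) :
    set 'cV[R]_n :=
  [set x | forall y, (F x <= F y)%E].

(* Main.v *)
(* Let F be the objective and x_k a minimizer of the coercive function
   F + l2norm ^+ 2 / (k + 1). If a subsequence of x_k is bounded, it accumulates
   at a minimizer of F. Otherwise x_k / l2norm x_k accumulates at some d in the
   kernel of the asymptotic function of phi, and asymptotic level stability gives
   phi (x_k - d) <= phi x_k for large k. The penalty does not increase either: a
   coordinate of B x_k is unchanged if (B d)_i = 0, and tends to infinity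
   otherwise, where the penalty has already reached its maximum. Since
   l2norm (x_k - d) < l2norm x_k, this contradicts the minimality of x_k. *)
Require Import Defs.
From mathcomp Require Import all_boot all_order all_algebra.
From mathcomp Require Import all_classical all_reals all_analysis.
From mathcomp Require Import ring lra.

Import Order.TTheory GRing.Theory Num.Theory.
Import numFieldNormedType.Exports.

Local Open Scope classical_set_scope.
Local Open Scope ring_scope.

(** * Compactness and lower semicontinuity *)

Lemma bolzano_weierstrass_cV {R : realType} {n : nat} {x : nat -> 'cV[R]_n} {M : R} :
  (forall k i, `|x k i ord0| <= M) ->
  exists (s : nat -> nat) (d : 'cV[R]_n),
    s k @[k --> \oo] --> \oo /\ x (s k) @[k --> \oo] --> d.
Proof.
move=> xM.
have cA : compact [set v : 'rV[R]_n | forall i, `[- M, M]%classic (v ord0 i)].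
  by apply: (@rV_compact _ _ (fun=> `[- M, M]%classic)) => _; exact: segment_compact.
pose z k := (x k)^T.
have [|d [_ dcl]] := cA (z k @[k --> \oo]) _.
  by exists 0%N => // k _ i /=; rewrite in_itv/= -ler_norml mxE.
(* The sequence meets every neighbourhood of its cluster point [d] beyond any rank. Choosing such an
   index at distance below [1/(k+1)] gives [s]; it need not be monotone, and [k <= s k] is enough
   for divergence. *)
have dx k : exists j, (k <= j)%N /\ forall i, `|d ord0 i - x j i ord0| < k.+1%:R^-1.
  have k0 : 0 < k.+1%:R^-1 :> R by [].
  have [] := dcl [set z j | j in [set j | (k <= j)%N]] (ball d k.+1%:R^-1).
  - by exists k => // j kj; exists j.
  - exact: nbhsx_ballx.
  - move=> _ [[j kj <-] [_ dj]]; exists j; split => // i.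
    by have := dj ord0 i; rewrite mxE.
pose s k := projT1 (cid (dx k)); have sP k := projT2 (cid (dx k)).
exists s, d^T; split.
  apply/cvgnyPge => A; near=> k; apply: (leq_trans _ (sP k).1).
  by near: k; exact: nbhs_infty_ge.
apply/cvg_ballP => e e0.
have := near_infty_natSinv_lt (PosNum e0); apply: filterS => k /= ke.
split=> // i j; rewrite ord1 mxE; apply: lt_trans ke; exact: (sP k).2.
Unshelve. all: by end_near. Qed.

(** If [a < F l], a real [b] strictly between separates them: [F] exceeds [b] near [l], yet is
    eventually at most [b] along the sequence. Asking for bounds by every [b > a] allows values that
    approach [a] from above. *)
Lemma lower_semicontinuous_lim {T : topologicalType} {R : realType}
    {F : T -> \bar R} {x : nat -> T} {l : T} {a : R} :
  lower_semicontinuous F -> x k @[k --> \oo] --> l ->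
  (forall b, a < b -> \forall k \near \oo, (F (x k) <= b%:E)%E) ->
  (F l <= a%:E)%E.
Proof.
move=> Flsc xl Fx; rewrite leNgt; apply/negP => aF.
have [b ab bF] : exists2 b, a < b & (b%:E < F l)%E.
  case: (F l) aF => [r| |] //; rewrite ?lte_fin => ar.
    by exists ((a + r) / 2); rewrite ?lte_fin; lra.
  by exists (a + 1); [lra|rewrite ltry].
have [V Vl VF] := Flsc _ _ bF.
have xV : \forall k \near \oo, V (x k) by exact: xl Vl.
have [k [/= Vxk]] := filter_ex (filterI xV (Fx _ ab)).
by move: Vxk => /VF; rewrite ltNge => /negP.
Qed.

Lemma lower_semicontinuousD_EFin {T : topologicalType} {R : realType}
    {F : T -> \bar R} {h : T -> R} :
  lower_semicontinuous F -> lower_semicontinuous (EFin \o h) ->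
  lower_semicontinuous (fun x => F x + (h x)%:E)%E.
Proof.
move=> Flsc hlsc x a aFh.
(* For finite [F x], the slack [F x + h x - a] is shared equally between the two terms. For
   [F x = +oo], [c] is just below [h x] and [b] takes up the rest. *)
have [b [c [abc bF ch]]] :
    exists b c, [/\ a = b + c, (b%:E < F x)%E & (c%:E < (h x)%:E)%E].
  case: (F x) aFh => [r| |] //; rewrite ?lte_fin => arh.
    exists (r - (r + h x - a) / 2), (h x - (r + h x - a) / 2).
    by rewrite !lte_fin; split; lra.
  by exists (a - h x + 1), (h x - 1); rewrite ltry lte_fin; split => //; lra.
have [V Vx VF] := Flsc _ _ bF; have [W Wx Wh] := hlsc _ _ ch.
exists (V `&` W); first exact: filterI.
by move=> y [/VF Fy /Wh hy]; rewrite abc EFinD lteD.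
Qed.

Lemma lower_semicontinuous_sum {T : topologicalType} {R : realType} {m : nat}
    {h : 'I_m -> T -> R} :
  (forall i, lower_semicontinuous (EFin \o h i)) ->
  lower_semicontinuous (fun x => (\sum_i h i x)%:E).
Proof.
elim: m h => [|m IH] h hlsc.
  move=> x a; rewrite big_ord0 => a0; exists setT; first exact: filterT.
  by move=> y _; rewrite big_ord0.
under eq_fun do rewrite big_ord_recr EFinD.
by apply: lower_semicontinuousD_EFin => //; exact: IH.
Qed.

Lemma continuous_lower_semicontinuous {T : topologicalType} {R : realType} {h : T -> R} :
  continuous h -> lower_semicontinuous (EFin \o h).
Proof.
move=> hc x a; rewrite lte_fin => ax; exists [set y | a < h y] => //.
exact: (cvgr_gt (h x) (hc x) a ax).
Qed.

Lemma lower_semicontinuous_comp {T U : topologicalType} {R : realType}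
    {F : U -> \bar R} {f : T -> U} :
  lower_semicontinuous F -> continuous f -> lower_semicontinuous (F \o f).
Proof.
move=> Flsc fc x a /Flsc [V Vx VF].
by exists (f @^-1` V); [exact: fc|move=> y /VF].
Qed.

Lemma continuous_mulmx_coord {R : realType} {m n : nat} (B : 'M[R]_(m, n)) i j :
  continuous (fun x : 'cV[R]_n => (B *m x) i j).
Proof.
under eq_fun do rewrite mxE.
apply: continuous_big => [|k _ x]; first exact: add_continuous.
have cx := @coord_continuous R n 1 k j x.
exact: (@continuousM R _ (fun=> B i k) (fun x : 'cV[R]_n => x k j) x
  (@cst_continuous _ _ _ x) cx).
Qed.

(** * Euclidean norm *)

Lemma l2norm_ge0 {R : realType} {n : nat} (x : 'cV[R]_n) : 0 <= l2norm x.
Proof. exact: sqrtr_ge0. Qed.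

Lemma sqr_l2norm {R : realType} {n : nat} (x : 'cV[R]_n) :
  l2norm x ^+ 2 = \sum_i x i ord0 ^+ 2.
Proof. by rewrite sqr_sqrtr// sumr_ge0// => i _; exact: sqr_ge0. Qed.

Lemma coord_le_l2norm {R : realType} {n : nat} (x : 'cV[R]_n) i :
  `|x i ord0| <= l2norm x.
Proof.
rewrite -(ler_pXn2r (n := 2))// ?nnegrE ?l2norm_ge0// real_normK ?num_real//.
rewrite sqr_l2norm (bigD1 i)//= lerDl sumr_ge0// => k _; exact: sqr_ge0.
Qed.

Lemma sqr_l2norm_continuous {R : realType} {n : nat} :
  continuous (fun x : 'cV[R]_n => l2norm x ^+ 2).
Proof.
under eq_fun do rewrite sqr_l2norm.
apply: continuous_big => [|k _ x]; first exact: add_continuous.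
have cx := @coord_continuous R n 1 k ord0 x.
exact: (@continuousM R _ (fun x : 'cV[R]_n => x k ord0)
  (fun x : 'cV[R]_n => x k ord0) x cx cx).
Qed.

(** * Quadratic regularization *)

Lemma lower_semicontinuous_regularized {R : realType} {n : nat} {F : 'cV[R]_n -> \bar R}
    (e : R) :
  lower_semicontinuous F ->
  lower_semicontinuous (fun x => F x + (e * l2norm x ^+ 2)%:E)%E.
Proof.
move=> Flsc; apply: lower_semicontinuousD_EFin => //.
apply: continuous_lower_semicontinuous => x.
exact: (@continuousM R _ (fun=> e) (fun x : 'cV[R]_n => l2norm x ^+ 2) x
  (@cst_continuous _ _ _ x) (sqr_l2norm_continuous x)).
Qed.

(** Direct method: the lower bound on [F] turns the quadratic term into a bound on any minimizing
    sequence, and lower semicontinuity lets a subsequential limit attain the infimum. *)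
Lemma regularized_minimizer {R : realType} {n : nat} {F : 'cV[R]_n -> \bar R} {e : R} :
  lower_semicontinuous F -> bounded_below F -> (exists x, F x != +oo%E) -> 0 < e ->
  global_minimizers (fun x => F x + (e * l2norm x ^+ 2)%:E)%E !=set0.
Proof.
move=> Flsc [c cF] [x0 Fx0] e0; set G := (fun x => _).
have cG x : (c%:E <= G x)%E.
  by rewrite -[c%:E]adde0 leeD// lee_fin mulr_ge0 ?sqr_ge0// ltW.
have infG x : (ereal_inf (range G) <= G x)%E.
  by apply: (@ereal_inf_lbound R (range G)); exists x.
have inf_fin : ereal_inf (range G) \is a fin_num.
  rewrite fin_real//; apply/andP; split.
    by apply: (@lt_le_trans _ _ c%:E); [exact: ltNyr|apply/ereal_infP => _ [x _ <-]].
  by apply: le_lt_trans (infG x0) _; rewrite lte_add_pinfty ?ltry// ltey.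
pose v := fine (ereal_inf (range G)).
have vE : ereal_inf (range G) = v%:E by rewrite fineK.
have approx k : exists x, (G x <= (v + k.+1%:R^-1)%:E)%E.
  have k0 : 0 < k.+1%:R^-1 :> R by [].
  have [_ [x _ <-]] := lb_ereal_inf_adherent k0 inf_fin.
  by rewrite vE -EFinD => /ltW; exists x.
pose x k := projT1 (cid (approx k)); have xP k := projT2 (cid (approx k)).
(* From [c + e * l ^+ 2 <= v + 1] one gets [l ^+ 2 <= (v + 1 - c) / e]; the extra [1] bounds [l]
   itself without a square root, since [l <= l ^+ 2 + 1]. *)
have [k i|s [d [soo xd]]] := @bolzano_weierstrass_cV R n x ((v + 1 - c) / e + 1).
  apply: le_trans (coord_le_l2norm _ _) _; set l := l2norm _.
  have : l ^+ 2 <= (v + 1 - c) / e.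
    rewrite ler_pdivlMr// mulrC -lee_fin.
    have : (c%:E + (e * l ^+ 2)%:E <= (v + 1)%:E)%E.
      apply: le_trans (leeD (cF _) (lexx _)) _; apply: le_trans (xP k) _.
      by rewrite lee_fin lerD2l invf_le1// ler1n.
    by rewrite -EFinD !lee_fin; lra.
  by nra.
exists d => y; apply: le_trans (infG y); rewrite vE.
apply: (lower_semicontinuous_lim (lower_semicontinuous_regularized e Flsc) xd) => b vb.
have bv0 : 0 < b - v by lra.
have sb : \forall k \near \oo, (s k).+1%:R^-1 < b - v.
  exact: soo _ (near_infty_natSinv_lt (PosNum bv0)).
apply: filterS sb => k kb.
by apply: le_trans (xP _) _; rewrite lee_fin -lerBrDl ltW.
Qed.

(** The last hypothesis is exactly what a regularized minimizer forbids: a point of smaller norm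
    whose value is no larger. It confines all knowledge of [phi] and of the penalty to one descent
    statement. *)
Lemma minimizer_of_descent {R : realType} {n : nat} {F : 'cV[R]_n -> \bar R} :
  lower_semicontinuous F -> bounded_below F -> (exists x, F x != +oo%E) ->
  (forall (x : nat -> 'cV[R]_n) (C : R), (forall k, (F (x k) <= C%:E)%E) ->
    l2norm (x k) @[k --> \oo] --> +oo ->
    exists k y, (F y <= F (x k))%E /\ l2norm y < l2norm (x k)) ->
  global_minimizers F !=set0.
Proof.
move=> Flsc Fbb [x0 Fx0] descent; have [c cF] := Fbb.
have k0 k : 0 < k.+1%:R^-1 :> R by [].
pose min_k k := cid (regularized_minimizer Flsc Fbb (ex_intro _ x0 Fx0) (k0 k)).
pose x k := projT1 (min_k k).
have xP k y : (F (x k) + (k.+1%:R^-1 * l2norm (x k) ^+ 2)%:E <=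
    F y + (k.+1%:R^-1 * l2norm y ^+ 2)%:E)%E by exact: (projT2 (min_k k)) y.
have Fx k y : (F (x k) <= F y + (k.+1%:R^-1 * l2norm y ^+ 2)%:E)%E.
  by apply: le_trans (xP k y); rewrite leeDl// lee_fin mulr_ge0 ?sqr_ge0// ltW.
have Ffin y : F y != +oo%E -> F y = (fine (F y))%:E.
  move=> Fy; rewrite fineK// fin_real// ltey Fy andbT.
  by apply: lt_le_trans (cF y); exact: ltNyr.
have [xoo|] := pselect (l2norm (x k) @[k --> \oo] --> +oo).
  (* Comparison with the fixed point [x0] bounds all values [F (x k)], because the weights [1/(k+1)]
     are at most 1. *)
  have [k|k [y [Fyx yx]]] := descent x (fine (F x0) + l2norm x0 ^+ 2) _ xoo.
    apply: le_trans (Fx k x0) _; rewrite {1}(Ffin x0)// -EFinD lee_fin lerD2l.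
    by rewrite ler_piMl ?sqr_ge0// invf_le1// ler1n.
  have Fxk : F (x k) != +oo%E.
    rewrite -ltey; apply: le_lt_trans (Fx k x0) _.
    by rewrite lte_add_pinfty ?ltry// ltey.
  have := le_trans (xP k y) (leeD Fyx (lexx _)).
  rewrite (Ffin (x k))// -!EFinD lee_fin lerD2l ler_pM2l//.
  by rewrite leNgt ltr_pXn2r ?nnegrE ?l2norm_ge0// yx.
move=> nxoo.
(* Failure of divergence only gives norms bounded by [M] infinitely often; [r] picks such indices
   with [N <= r N]. *)
have [M xM] : exists M, forall N, exists k, (N <= k)%N /\ l2norm (x k) <= M.
  apply: contrapT => /forallNP noM; apply: nxoo; apply/cvgryPgt => A.
  have /existsNP[N NP] := noM A; exists N => // k /= Nk.
  by rewrite ltNge; apply/negP => xkA; apply: NP; exists k.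
pose r N := projT1 (cid (xM N)); have rP N := projT2 (cid (xM N)).
have [k i|s [d [soo xd]]] := @bolzano_weierstrass_cV R n (x \o r) M.
  by apply: le_trans (coord_le_l2norm _ _) (rP k).2.
exists d => y; have [->|Fy] := eqVneq (F y) +oo%E; first by rewrite leey.
rewrite (Ffin y)//; apply: (lower_semicontinuous_lim Flsc xd) => b yb.
(* Once the weight is below [q], the quadratic term at [y] is at most [b - F y]; the [+ 1] keeps the
   denominator positive when [y = 0]. *)
pose q := (b - fine (F y)) / (l2norm y ^+ 2 + 1).
have y1 : 0 < l2norm y ^+ 2 + 1 by rewrite ltr_wpDl ?sqr_ge0.
have q0 : 0 < q by rewrite divr_gt0// subr_gt0.
have sq : \forall k \near \oo, (s k).+1%:R^-1 < q.
  exact: soo _ (near_infty_natSinv_lt (PosNum q0)).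
apply: filterS sq => k kq.
apply: le_trans (Fx _ y) _; rewrite {1}(Ffin y)// -EFinD lee_fin -lerBrDl.
have kr : (r (s k)).+1%:R^-1 <= q.
  apply: le_trans (ltW kq); rewrite lef_pV2 ?posrE// ler_nat ltnS.
  exact: (rP (s k)).1.
apply: le_trans (ler_wpM2r (sqr_ge0 _) kr) _.
have -> : b - fine (F y) = q * (l2norm y ^+ 2 + 1).
  by rewrite divfK// gt_eqF.
by rewrite ler_pM2l// lerDl.
Qed.

(** * Shifts along an asymptotic direction *)

Lemma asymptotic_ker_sublevel {R : realType} {n : nat} {phi : 'cV[R]_n -> \bar R}
    {x : nat -> 'cV[R]_n} {d : 'cV[R]_n} {C : R} :
  bounded_below phi -> (forall k, (phi (x k) <= C%:E)%E) ->
  l2norm (x k) @[k --> \oo] --> +oo ->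
  (l2norm (x k))^-1 *: x k @[k --> \oo] --> d ->
  asymptotic_ker phi d.
Proof.
move=> [c cphi] phiC xoo xd.
rewrite /asymptotic_ker/= /asymptotic_fun limf_einfE; apply/eqP; rewrite eq_le.
apply/andP; split.
  (* Upper bound: for large [k] every neighbourhood of [(d, +oo)] contains the normalized [x k]
     paired with its norm. The quotient there is at most [C / l2norm (x k)], hence at most [e]. *)
  apply/ereal_supP => _ [V [[P Q] /= [Pd Qoo] PQV] <-].
  apply/lee_addgt0Pr => e e0; rewrite add0e.
  have xP : \forall k \near \oo, P ((l2norm (x k))^-1 *: x k) by exact: xd Pd.
  have xQ : \forall k \near \oo, Q (l2norm (x k)) by exact: xoo Qoo.
  have xC : \forall k \near \oo, (`|C| + 1) / e <= l2norm (x k).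
    exact: cvgry_ge xoo _.
  have [k [[/= Pk Qk] Ck]] := filter_ex (filterI (filterI xP xQ) xC).
  have C1 : 0 < `|C| + 1 by rewrite ltr_wpDl.
  have xk0 : 0 < l2norm (x k) by apply: lt_le_trans Ck; rewrite divr_gt0.
  apply: ge_ereal_inf; exists (phi (x k) * (l2norm (x k))^-1%:E)%E.
    exists ((l2norm (x k))^-1 *: x k, l2norm (x k)); first exact: PQV.
    by rewrite /= scalerA divff ?gt_eqF// scale1r.
  apply: (@le_trans _ _ (C%:E * (l2norm (x k))^-1%:E)%E).
    by rewrite lee_wpmul2r// lee_fin invr_ge0 ltW.
  rewrite -EFinM lee_fin ler_pdivrMr// mulrC -ler_pdivrMr//.
  apply: le_trans Ck; rewrite ler_pM2r ?invr_gt0//.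
  by rewrite (le_trans (ler_norm C))// lerDl.
(* Lower bound: in every direction the quotient is at least [c / t], which is at least [-e] for
   [t > (|c| + 1) / e]. *)
apply/lee_subgt0Pr => e e0; rewrite sub0e.
apply: le_ereal_sup_tmp.
pose V := [set u : 'cV[R]_n * R | (`|c| + 1) / e < u.2].
exists (ereal_inf ((fun u => phi (u.2 *: u.1)%R * (u.2^-1)%:E)%E @` V)).
  exists V => //; exists (setT, [set t | (`|c| + 1) / e < t]) => /=.
    by split; [exact: filterT|exact: nbhs_pinfty_gt (num_real _)].
  by move=> u [].
apply/ereal_infP => _ [u Vu <-]; have {}Vu : (`|c| + 1) / e < u.2 by exact: Vu.
have c1 : 0 < `|c| + 1 by rewrite ltr_wpDl.
have u0 : 0 < u.2 by apply: lt_trans Vu; rewrite divr_gt0.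
apply: (@le_trans _ _ (c%:E * (u.2^-1)%:E)%E); last first.
  by rewrite lee_wpmul2r// lee_fin invr_ge0 ltW.
rewrite -EFinM lee_fin ler_pdivlMr// mulNr lerNl.
move: Vu; rewrite ltr_pdivrMr// mulrC => /ltW; apply: le_trans.
by rewrite (le_trans (ler_norm _))// normrN lerDl.
Qed.

Lemma sqr_l2normB {R : realType} {n : nat} (x d : 'cV[R]_n) :
  l2norm (x - d) ^+ 2 =
  l2norm x ^+ 2 - 2 * (d^T *m x) ord0 ord0 + l2norm d ^+ 2.
Proof.
rewrite !sqr_l2norm mxE mulr_sumr -sumrB -big_split/=.
by apply: eq_bigr => i _; rewrite !mxE; ring.
Qed.

Lemma l2normZ {R : realType} {n : nat} (a : R) (x : 'cV[R]_n) :
  l2norm (a *: x) = `|a| * l2norm x.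
Proof.
rewrite /l2norm -sqrtr_sqr -sqrtrM ?sqr_ge0//; congr Num.sqrt.
by rewrite mulr_sumr; apply: eq_bigr => i _; rewrite mxE exprMn.
Qed.

(** Both penalties are sums of one scalar cost that attains its maximum [M] at every argument of
    modulus at least [T], so no shift can raise the cost of a coordinate that has become large. *)
Lemma separable_penalty_minimizer {R : realType} {m n : nat}
    {phi : 'cV[R]_n -> \bar R} (B : 'M[R]_(m, n)) {g : R -> R} {M T : R} :
  proper_fun phi -> lower_semicontinuous phi ->
  asymptotically_level_stable phi -> bounded_below phi ->
  lower_semicontinuous (EFin \o g) ->
  (forall t, 0 <= g t <= M) -> (forall t, T <= `|t| -> g t = M) ->
  global_minimizers
    (fun x => phi x + (\sum_i g ((B *m x) i ord0))%:E)%E !=set0.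
Proof.
move=> [phiNy [x0 phix0]] phi_lsc phi_als phi_bb glsc g0M gM.
have [c cphi] := phi_bb.
pose h (x : 'cV[R]_n) := \sum_i g ((B *m x) i ord0).
have h0 x : 0 <= h x by apply: sumr_ge0 => i _; have /andP[] := g0M ((B *m x) i ord0).
have cF x : (phi x <= phi x + (h x)%:E)%E by rewrite leeDl// lee_fin.
apply: minimizer_of_descent.
- apply: lower_semicontinuousD_EFin => //; apply: lower_semicontinuous_sum => i.
  exact: (lower_semicontinuous_comp glsc (continuous_mulmx_coord B i ord0)).
- by exists c => x; apply: le_trans (cF x).
- by exists x0; rewrite -ltey lte_add_pinfty ?ltry// ltey.
move=> x C xC xoo.
have [k i|s [d [soo ud]]] :=
    @bolzano_weierstrass_cV R n (fun k => (l2norm (x k))^-1 *: x k) 1.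
  apply: le_trans (coord_le_l2norm _ _) _.
  rewrite l2normZ ger0_norm ?invr_ge0 ?l2norm_ge0//.
  have [->|xk0] := eqVneq (l2norm (x k)) 0; first by rewrite mulr0.
  by rewrite mulVf.
pose z := x \o s; have {}ud : (l2norm (z k))^-1 *: z k @[k --> \oo] --> d by [].
have zoo : l2norm (z k) @[k --> \oo] --> +oo.
  by apply/cvgryPgt => A; exact: soo _ (cvgry_gt xoo A).
have phizC k : (phi (z k) <= C%:E)%E by apply: le_trans (cF _) (xC _).
(* Needed for [B] and also for the one-row matrix [d^T], which yields the inner product with [d]. *)
have coord_cvg (l : nat) (A : 'M[R]_(l, n)) i :
    (l2norm (z k))^-1 * (A *m z k) i ord0 @[k --> \oo] --> (A *m d) i ord0.
  have := cvg_comp _ _ ud (continuous_mulmx_coord A i ord0 d).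
  by under [X in X @ _]eq_fun do rewrite /= -scalemxAr mxE.
have d1 : l2norm d ^+ 2 = 1.
  have lim_d := cvg_comp _ _ ud (sqr_l2norm_continuous d).
  apply: (cvg_unique _ lim_d) => //.
  apply: cvg_near_cst; apply: filterS (cvgry_gt zoo 0) => k zk.
  by rewrite /= l2normZ ger0_norm ?invr_ge0 ?ltW// mulVf ?expr1n ?gt_eqF.
have zfin k : phi (z k) = (fine (phi (z k)))%:E.
  rewrite fineK// fin_real// (lt_le_trans _ (cphi _)) ?ltNyr//=.
  exact: le_lt_trans (phizC k) (ltry _).
(* The levels are the values [phi (z k)] themselves, which lie between [c] and [C]. With [rho = 1],
   level stability then says that subtracting [d] does not increase [phi]. *)
have [k0 k0P] : exists k0, forall k, (k0 <= k)%N ->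
    lev phi (fine (phi (z k))) (z k - 1 *: d).
  apply: (phi_als 1 _ z d) => //.
  - rewrite /= /bounded_near; near=> K; move=> k _ /=.
    apply: (@le_trans _ _ (`|c| + `|C|)); last first.
      by near: K; exact: nbhs_pinfty_ge (num_real _).
    have := phizC k; have := cphi (z k); rewrite zfin !lee_fin ler_norml.
    have := ler_norm C; have := lerNnormlW (lexx `|c|).
    have := normr_ge0 C; have := normr_ge0 c; lra.
  - by move=> k; rewrite /lev/= -zfin.
  - exact: asymptotic_ker_sublevel phi_bb phizC zoo ud.
have phi_dec : \forall k \near \oo, (phi (z k - d)%R <= phi (z k))%E.
  by exists k0 => // k /k0P; rewrite /lev/= scale1r -zfin.
have g_dec i : \forall k \near \oo,
    g ((B *m (z k - d)) i ord0) <= g ((B *m z k) i ord0).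
  have [Bd0|Bd0] := eqVneq ((B *m d) i ord0) 0.
    apply: nearW => k; rewrite mulmxBr !mxE.
    by move: Bd0; rewrite mxE => ->; rewrite subr0.
  (* Eventually the normalized coordinate has at least half the modulus of its limit, so the
     coordinate of [B *m z k] has modulus at least [T] once [l2norm (z k)] passes the threshold
     below. *)
  have b0 : 0 < `|(B *m d) i ord0| / 2 by rewrite divr_gt0// normr_gt0.
  near=> k.
  have zk0 : 0 < l2norm (z k) by near: k; exact: cvgry_gt zoo _.
  have zkT : `|T| / (`|(B *m d) i ord0| / 2) <= l2norm (z k).
    by near: k; exact: cvgry_ge zoo _.
  have Bzk : `|(B *m d) i ord0| / 2 <= `|(l2norm (z k))^-1 * (B *m z k) i ord0|.
    have : `|(B *m d) i ord0 - (l2norm (z k))^-1 * (B *m z k) i ord0|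
        < `|(B *m d) i ord0| / 2.
      by near: k; exact: cvgr_dist_lt (coord_cvg _ B i) _ b0.
    set a := (B *m d) i ord0; set b := _^-1 * _.
    have := ler_normD (a - b) b; rewrite subrK; lra.
  rewrite (gM ((B *m z k) i ord0)).
    by have /andP[] := g0M ((B *m (z k - d)) i ord0).
  apply: le_trans (ler_norm T) _; move: zkT; rewrite ler_pdivrMr// => /le_trans; apply.
  by move: Bzk; rewrite normrM normfV (ger0_norm (l2norm_ge0 _)) ler_pdivlMl.
have h_dec : \forall k \near \oo, h (z k - d) <= h (z k).
  near=> k; apply: ler_sum => i _; move: i.
  by near: k; exact: filter_forall.
(* The squared norm changes by [1 - 2 <d, z k>]. Since [<d, z k> / l2norm (z k)] tends to 1,
   eventually [2 <d, z k> > l2norm (z k) > 1]. *)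
have norm_dec : \forall k \near \oo, l2norm (z k - d) < l2norm (z k).
  have dd : (d^T *m d) ord0 ord0 = 1.
    by rewrite -d1 sqr_l2norm mxE; apply: eq_bigr => i _; rewrite mxE expr2.
  near=> k.
  have zk1 : 1 < l2norm (z k) by near: k; exact: cvgry_gt zoo _.
  have dz : 2^-1 < (l2norm (z k))^-1 * (d^T *m z k) ord0 ord0.
    near: k; apply: cvgr_gt (coord_cvg _ d^T ord0) _ _.
    by rewrite dd; lra.
  have zk0 : 0 < l2norm (z k) by apply: lt_trans zk1.
  rewrite -(ltr_pXn2r (n := 2)) ?nnegrE ?l2norm_ge0//.
  rewrite sqr_l2normB d1; move: dz; rewrite ltr_pdivlMl//.
  by lra.
have [k [[/= phik hk] nk]] := filter_ex (filterI (filterI phi_dec h_dec) norm_dec).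
by exists (s k), (z k - d); split => //; apply: leeD => //; rewrite lee_fin.
Unshelve. all: by end_near. Qed.

(** * The two scalar costs and the conclusion *)

Lemma lower_semicontinuousZ {T : topologicalType} {R : realType} {h : T -> R} {a : R} :
  0 < a -> lower_semicontinuous (EFin \o h) ->
  lower_semicontinuous (EFin \o (fun x => a * h x)).
Proof.
move=> a0 hlsc x b; rewrite lte_fin -ltr_pdivrMl// -lte_fin => /hlsc[V Vx hV].
by exists V => // y /hV; rewrite !lte_fin ltr_pdivrMl.
Qed.

(** At 0 the indicator takes its least value, and away from 0 it is locally constant. *)
Lemma neq0_lower_semicontinuous {R : realType} :
  lower_semicontinuous (fun t : R => (t != 0)%:R%:E : \bar R).
Proof.
move=> t a; have [->|t0 at1] := eqVneq t 0.
  move=> a0; exists setT; first exact: filterT.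
  by move=> y _; apply: lt_le_trans a0 _; rewrite lee_fin ler0n.
exists [set s | 0 < `|s|]; last by move=> s; rewrite /= normr_gt0 => ->.
by apply: (cvgr_gt `|t| (@norm_continuous _ R t)); rewrite normr_gt0.
Qed.

Lemma capped_fun_lower_semicontinuous {R : realType} {p gamma : R} :
  0 < p -> 0 < gamma -> lower_semicontinuous (EFin \o capped_fun p gamma).
Proof.
move=> p0 g0 t a; rewrite /= lte_fin /capped_fun lt_min => /andP[at_ a1].
have [a0|a0] := ltP a 0.
  exists setT; first exact: filterT.
  move=> s _; rewrite lte_fin lt_min a1 andbT (lt_le_trans a0)//.
  by rewrite mulr_ge0 ?powR_ge0 ?ltW.
have ag0 : 0 <= a / gamma by rewrite divr_ge0// ltW.
(* For [a >= 0], [a < gamma * |s|^p] is equivalent to this bound on [|s|] by monotonicity of powers,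
   so continuity of the norm suffices. *)
exists [set s | (a / gamma) `^ p^-1 < `|s|].
  apply: (cvgr_gt `|t| (@norm_continuous _ R t)).
  have atg : a / gamma < `|t| `^ p by rewrite ltr_pdivrMr// mulrC.
  have pV0 : 0 < p^-1 by rewrite invr_gt0.
  have := gt0_ltr_powR pV0 ag0 (powR_ge0 _ _ : `|t| `^ p \in Num.nneg) atg.
  by rewrite -powRrM divff ?gt_eqF// powRr1.
move=> s /= /(gt0_ltr_powR p0 _ _); rewrite !nnegrE -powRrM mulVf ?gt_eqF//.
rewrite powRr1// => /(_ (powR_ge0 _ _) (normr_ge0 _)).
by rewrite ltr_pdivrMr// mulrC => ags; rewrite lte_fin lt_min ags.
Qed.

(** The threshold is the nonnegative solution of [gamma * t^p = 1]. *)
Lemma capped_fun_saturated {R : realType} {p gamma t : R} :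
  0 < p -> 0 < gamma -> gamma^-1 `^ p^-1 <= `|t| -> capped_fun p gamma t = 1.
Proof.
move=> p0 g0 gt; rewrite /capped_fun min_r// -ler_pdivrMl// mulr1.
have := ge0_ler_powR (ltW p0) (powR_ge0 _ _ : _ \in Num.nneg)
  (normr_ge0 t : `|t| \in Num.nneg) gt.
by rewrite -powRrM mulVf ?gt_eqF// powRr1// invr_ge0 ltW.
Qed.

Theorem theorem3p2 (R : realType) (m n : nat) (phi : 'cV[R]_n -> \bar R)
    (B : 'M[R]_(m, n)) (lambda p gamma : R)
    (phi_proper : proper_fun phi)
    (phi_lsc : lower_semicontinuous phi)
    (phi_als : asymptotically_level_stable phi)
    (phi_bounded_below : bounded_below phi)
    (lambda_gt0 : 0 < lambda) (p_gt0 : 0 < p) (gamma_gt0 : 0 < gamma) :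
  global_minimizers
    (fun x => phi x + (lambda * (l0norm (B *m x))%:R)%:E)%E !=set0 /\
  global_minimizers
    (fun x => phi x + (lambda * capped_lp p gamma (B *m x))%:E)%E !=set0.
Proof.
split.
  have l0E x : lambda * (l0norm (B *m x))%:R =
      \sum_i lambda * ((B *m x) i ord0 != 0)%:R.
    rewrite -mulr_sumr /l0norm -sum1_card natr_sum big_mkcond/=.
    by congr (_ * _); apply: eq_bigr => i _; rewrite inE; case: ifP.
  under eq_fun do rewrite l0E.
  (* Any positive [T] would serve, as the indicator is maximal at every nonzero argument; [lambda]
     is absorbed into the cost. *)
  apply: (separable_penalty_minimizer B (g := fun t => lambda * (t != 0)%:R)
    (M := lambda) (T := 1)) => //.
  - exact: (lower_semicontinuousZ lambda_gt0 neq0_lower_semicontinuous).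
  - by move=> t; case: (t != 0); rewrite ?mulr1 ?mulr0 lexx ltW.
  - by move=> t t1; rewrite -normr_gt0 (lt_le_trans ltr01 t1) mulr1.
under eq_fun do rewrite /capped_lp mulr_sumr.
apply: (separable_penalty_minimizer B (g := fun t => lambda * capped_fun p gamma t)
  (M := lambda) (T := gamma^-1 `^ p^-1)) => //.
- apply: lower_semicontinuousZ => //; exact: capped_fun_lower_semicontinuous.
- move=> t; have /andP[c0 c1] : 0 <= capped_fun p gamma t <= 1.
    rewrite /capped_fun le_min ler01 ge_min lexx orbT !andbT.
    by rewrite mulr_ge0 ?powR_ge0 ?(ltW gamma_gt0).
  by rewrite mulr_ge0 ?(ltW lambda_gt0)//= ler_piMr ?(ltW lambda_gt0).
- by move=> t /(capped_fun_saturated p_gt0 gamma_gt0) ->; rewrite mulr1.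
Qed.
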